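(* Let $W_c$ be a stochastic control Lyapunov-barrier function for the system $d\mathbf{x}=(f(\mathbf{x})+g(\mathbf{x})\mathbf{u})\,dt+\sigma(\mathbf{x})\,dW$ with input set $U=\{\mathbf{u}\in\mathbb{R}^m:\|\mathbf{u}\|\le u^{max}\}$, let $V_c(\mathbf{x})=W_c(\mathbf{x})-W_c(0)$ and $\rho>0$, and put $$a=L_fW_c(\mathbf{x})+\tfrac12\mathrm{tr}\Big(\sigma^T(\mathbf{x})\tfrac{\partial^2W_c}{\partial\mathbf{x}^2}\sigma(\mathbf{x})\Big)+\rho V_c(\mathbf{x}),\qquad \mathbf{b}=L_gW_c(\mathbf{x}),$$ $$\boldsymbol\phi(\mathbf{x})=\begin{cases}-\dfrac{a+\sqrt{a^2+\|u^{max}\mathbf{b}\|^4}}{\|\mathbf{b}\|^2\big[1+\sqrt{1+\|u^{max}\mathbf{b}\|^2}\big]}\,\mathbf{b}^T,&\mathbf{b}\ne0,\\[2mm]0,&\mathbf{b}=0.\end{cases}$$ Let $X_\phi=\{\mathbf{x}: a\le\|u^{max}\mathbf{b}\|\}$. Then for all $\mathbf{x}\in X_\phi$ with $\mathbf{x}\ne0$, $$\boldsymbol\phi(\mathbf{x})\in U\qquad\text{and}\qquad \mathcal{L}W_c(\mathbf{x},\boldsymbol\phi(\mathbf{x}))\le-\rho V_c(\mathbf{x})<0 .$$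
   Context: System: state $\mathbf{x}\in X\subseteq\mathbb{R}^n$, $W$ an $n$-dimensional Brownian motion, $f,g,\sigma$ locally Lipschitz. For a twice differentiable $F:X\to\mathbb{R}$ and input $\mathbf{u}$, $\mathcal{L}F(\mathbf{x},\mathbf{u})=L_fF(\mathbf{x})+L_gF(\mathbf{x})\mathbf{u}+\tfrac12\mathrm{tr}\big(\sigma^T(\mathbf{x})\tfrac{\partial^2F}{\partial\mathbf{x}^2}\sigma(\mathbf{x})\big)$, with $L_fF=\frac{\partial F}{\partial\mathbf{x}}f$ and $L_gF=\frac{\partial F}{\partial\mathbf{x}}g$ (a row vector). Stochastic control Lyapunov-barrier function for an unsafe region $D\subseteq X$ ($D$ a finite union of disjoint simply connected open sets): a twice differentiable $W_c:X\to\mathbb{R}$ which has a minimum at the origin and satisfies (i) $W_c(\mathbf{x})>0$ for all $\mathbf{x}\in D$; (ii) $\inf_{\mathbf{u}\in U}\mathcal{L}W_c(\mathbf{x},\mathbf{u})<0$ for all $\mathbf{x}\in X\setminus(D\cup\{0\})$; (iii) $\{\mathbf{x}\in X:W_c(\mathbf{x})\le0\}\neq\varnothing$. For such $W_c$ the function $V_c=W_c-W_c(0)$ is positive for $\mathbf{x}\in X$, $\mathbf{x}\ne0$. *)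

(* Defs.v *)
From HB Require Import structures.
From mathcomp Require Import all_boot all_order all_algebra.
From mathcomp Require Import all_classical all_reals all_analysis.

Set Implicit Arguments.
Unset Strict Implicit.
Unset Printing Implicit Defensive.

Import Order.TTheory GRing.Theory Num.Theory.
Import numFieldNormedType.Exports.

Local Open Scope classical_set_scope.
Local Open Scope ring_scope.

(* The library norm `|u| on matrices is the sup norm; this is the Euclidean
   norm when p = 1 or q = 1, the only cases in which it is used. *)
Definition enorm (R : realType) (p q : nat) (u : 'M[R]_(p, q)) : R :=
  Num.sqrt (\sum_(i < p) \sum_(j < q) u i j ^+ 2).

(* Stated with the sup norms of the library; since norms on R^n are equivalent,
   the notion does not depend on this choice. *)
Definition locally_lipschitz (R : realType) (V W : normedModType R)
    (X : set V) (h : V -> W) : Prop :=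
  forall x, X x ->
    exists2 N : set V, nbhs x N & [lipschitz h y | y in N `&` X].

Section differential_calculus.
Context {R : realType} {n : nat}.
Implicit Types (F : 'cV[R]_n -> R) (x : 'cV[R]_n).

Definition basis_vec (i : 'I_n) : 'cV[R]_n := delta_mx i 0.

Definition gradient F x : 'rV[R]_n := \row_j 'D_(basis_vec j) F x.

Definition hessian F x : 'M[R]_n :=
  \matrix_(i, j) 'D_(basis_vec i) ('D_(basis_vec j) F) x.

(* A function on an open set X is represented by a total function, of which
   only the values on X matter.  Continuity of the second derivatives is not
   required. *)
Definition twice_differentiable (X : set 'cV[R]_n) F : Prop :=
  forall x, X x -> differentiable F x /\ differentiable (gradient F) x.

End differential_calculus.

Section simply_connected.
Context {R : realType} {T : topologicalType}.

Local Notation I01 := [set` `[0 : R, 1]].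

Definition path_in (A : set T) (c : R -> T) : Prop :=
  {within I01, continuous c} /\ (forall t, I01 t -> A (c t)).

Definition path_connected (A : set T) : Prop :=
  forall x y, A x -> A y -> exists c, [/\ path_in A c, c 0 = x & c 1 = y].

(* H (s, _) is the loop at time s of the contraction of c inside A. *)
Definition null_homotopic_in (A : set T) (c : R -> T) : Prop :=
  exists H : R * R -> T,
    [/\ {within I01 `*` I01, continuous H},
        (forall p, (I01 `*` I01) p -> A (H p)),
        (forall t, I01 t -> H (0, t) = c t /\ H (1, t) = c 0) &
        (forall s, I01 s -> H (s, 0) = c 0 /\ H (s, 1) = c 0)].

Definition simply_connected (A : set T) : Prop :=
  path_connected A /\
  (forall c, path_in A c -> c 0 = c 1 -> null_homotopic_in A c).

End simply_connected.

Arguments simply_connected R {T} A.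

Definition unsafe_region (R : realType) (n : nat) (X D : set 'cV[R]_n) : Prop :=
  D `<=` X /\
  exists (k : nat) (C : 'I_k -> set 'cV[R]_n),
    [/\ D = \bigcup_i C i, trivIset setT C &
        forall i, open (C i) /\ simply_connected R (C i)].

(* The controlled diffusion dx = (f(x) + g(x) u) dt + sigma(x) dW enters only
   through its coefficients. *)
Section sclbf.
Context {R : realType} {n m : nat}.
Variables (f : 'cV[R]_n -> 'cV[R]_n) (g : 'cV[R]_n -> 'M[R]_(n, m))
  (sigma : 'cV[R]_n -> 'M[R]_n).
Implicit Types (F W : 'cV[R]_n -> R) (x : 'cV[R]_n) (u : 'cV[R]_m).

Definition Lf F x : R := (gradient F x *m f x) 0 0.

Definition Lg F x : 'rV[R]_m := gradient F x *m g x.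

Definition ito_term F x : R :=
  2^-1 * \tr ((sigma x)^T *m hessian F x *m sigma x).

Definition generator F x u : R :=
  Lf F x + (Lg F x *m u) 0 0 + ito_term F x.

(* The infimum is taken in the extended reals, so that it is meaningful for
   every input set U. *)
Definition sclbf (X : set 'cV[R]_n) (U : set 'cV[R]_m) (D : set 'cV[R]_n)
    (W : 'cV[R]_n -> R) : Prop :=
  [/\ twice_differentiable X W,
      X 0 /\ (forall x, X x -> W 0 <= W x),
      (forall x, D x -> 0 < W x),
      (forall x, (X `\` (D `|` [set 0])) x ->
         (ereal_inf [set (generator W x u)%:E | u in U] < 0)%E) &
      [set x | X x /\ W x <= 0] !=set0].

Definition Vc W x : R := W x - W 0.

Definition input_ball (umax : R) : set 'cV[R]_m := [set u | enorm u <= umax].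

Definition coef_a (rho : R) W x : R := Lf W x + ito_term W x + rho * Vc W x.

Definition phi (umax rho : R) W x : 'cV[R]_m :=
  let a := coef_a rho W x in
  let b := Lg W x in
  if b == 0 then 0
  else - ((a + Num.sqrt (a ^+ 2 + enorm (umax *: b) ^+ 4))
          / (enorm b ^+ 2 * (1 + Num.sqrt (1 + enorm (umax *: b) ^+ 2))))
       *: b^T.

Definition X_phi (X : set 'cV[R]_n) (umax rho : R) W : set 'cV[R]_n :=
  [set x | X x /\ coef_a rho W x <= enorm (umax *: Lg W x)].

End sclbf.

(* Main.v *)
(* The origin is the only minimum of W_c: at any other one the gradient vanishes
   and the Hessian is positive semidefinite (second-derivative test along
   lines), so L W_c >= 0 for every input.  Hence V_c > 0 away from 0.  With
   beta = |umax b|, S = sqrt (a^2 + beta^4) and T = 1 + sqrt (1 + beta^2), the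
   input bound reads a + S <= beta T and the decrease condition a T <= a + S.
   Both follow from a <= beta: the left side of the first increases with a and
   equals beta T at a = beta; the second reduces to a^2 beta^2 <= beta^4. *)
Require Import Defs.
From mathcomp Require Import all_boot all_order all_algebra.
From mathcomp Require Import all_classical all_reals all_analysis.
From mathcomp Require Import ring lra.

Set Implicit Arguments.
Unset Strict Implicit.
Unset Printing Implicit Defensive.

Import Order.TTheory GRing.Theory Num.Theory.
Import numFieldNormedType.Exports.

Local Open Scope classical_set_scope.
Local Open Scope ring_scope.

(** * Euclidean norm and the two scalar inequalities behind the control law *)

Lemma enormZ (R : realType) (p q : nat) (k : R) (u : 'M[R]_(p, q)) :
  enorm (k *: u) = `|k| * enorm u.
Proof.
rewrite /enorm -sqrtr_sqr -sqrtrM ?sqr_ge0// mulr_sumr; congr Num.sqrt.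
by apply: eq_bigr => i _; rewrite mulr_sumr; apply: eq_bigr => j _; rewrite mxE exprMn.
Qed.

Lemma enormT (R : realType) (p q : nat) (u : 'M[R]_(p, q)) :
  enorm u^T = enorm u.
Proof.
rewrite /enorm exchange_big; congr Num.sqrt.
by apply: eq_bigr => i _; apply: eq_bigr => j _; rewrite mxE.
Qed.

Lemma enorm_gt0 (R : realType) (p q : nat) (u : 'M[R]_(p, q)) :
  u != 0 -> 0 < enorm u.
Proof.
case/matrix0Pn => i [j uij]; rewrite /enorm sqrtr_gt0 (bigD1 i)//= (bigD1 j)//= -addrA.
rewrite ltr_pwDl ?exprn_even_gt0// addr_ge0 ?sumr_ge0// => *; rewrite ?sqr_ge0//.
by rewrite sumr_ge0// => *; rewrite sqr_ge0.
Qed.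

Lemma mulmx_row_trmx (R : realType) (m : nat) (b : 'rV[R]_m) :
  (b *m b^T) 0 0 = enorm b ^+ 2.
Proof.
rewrite /enorm sqr_sqrtr; last by do 2!apply: sumr_ge0 => ? _; rewrite sqr_ge0.
by rewrite big_ord1 mxE; apply: eq_bigr => j _; rewrite mxE expr2.
Qed.

(** With [T] the root alone, [T ^+ 2 = 1 + b ^+ 2] makes the square of [b * (1 + T) - a] exceed
    [a ^+ 2 + b ^+ 4] by the nonnegative [2 * b * (1 + T) * (b - a)]. *)
Lemma sontag_numerator_le (R : realType) (a b : R) : 0 <= b -> a <= b ->
  a + Num.sqrt (a ^+ 2 + b ^+ 4) <= b * (1 + Num.sqrt (1 + b ^+ 2)).
Proof.
move=> b0 ab; set S := Num.sqrt (a ^+ 2 + _); set T := Num.sqrt (1 + _).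
have S2 : S ^+ 2 = a ^+ 2 + b ^+ 4.
  by rewrite sqr_sqrtr// addr_ge0 ?sqr_ge0 ?exprn_ge0.
have T2 : T ^+ 2 = 1 + b ^+ 2 by rewrite sqr_sqrtr// addr_ge0 ?sqr_ge0.
have T1 : 1 <= T by rewrite -(@ler_sqr _ 1) ?nnegrE ?sqrtr_ge0// expr1n T2 lerDl sqr_ge0.
suff : S <= b * (1 + T) - a by lra.
have rhs0 : 0 <= b * (1 + T) - a by nra.
rewrite -ler_sqr ?nnegrE ?sqrtr_ge0// S2.
have -> : (b * (1 + T) - a) ^+ 2 = a ^+ 2 + b ^+ 4 + 2 * b * (1 + T) * (b - a).
  by rewrite sqrrB exprMn sqrrD T2 expr1n; ring.
by rewrite lerDl; apply: mulr_ge0; [nra|lra].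
Qed.

(** After cancelling [a], only positive [a] needs work; there, squaring leaves
    [a ^+ 2 * b ^+ 2 <= b ^+ 4]. *)
Lemma sontag_numerator_ge (R : realType) (a b : R) : 0 <= b -> a <= b ->
  a * (1 + Num.sqrt (1 + b ^+ 2)) <= a + Num.sqrt (a ^+ 2 + b ^+ 4).
Proof.
move=> b0 ab; rewrite mulrDr mulr1 lerD2l.
have [a0|/ltW a0] := leP a 0.
  by rewrite (le_trans (mulr_le0_ge0 a0 (sqrtr_ge0 _)))// sqrtr_ge0.
rewrite -[X in X * _]ger0_norm// -sqrtr_sqr -sqrtrM ?sqr_ge0// ler_wsqrtr//.
by rewrite mulrDr mulr1 lerD2l -[4%N]/(2 + 2)%N exprD ler_wpM2r ?sqr_ge0// ler_sqr ?nnegrE.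
Qed.

(** * Minimum tests in one real variable *)

Section second_order.
Context {R : realType}.

Lemma near0_itv (P : set R) : (\forall t \near (0 : R), P t) ->
  exists2 e : R, 0 < e & forall t, t \in `]-e, e[ -> P t.
Proof.
move=> /nbhs_ballP[e e0 eP]; exists e => // t; rewrite in_itv /= -ltr_norml => te.
by apply: eP; rewrite -ball_normE /= sub0r normrN.
Qed.

Lemma derive_eq0_at_min (h dh : R -> R) :
  (\forall t \near (0 : R), is_derive t (1 : R) h (dh t)) ->
  (\forall t \near (0 : R), h 0 <= h t) -> dh 0 = 0.
Proof.
move=> hdh hmin.
have [e e0 eP] := near0_itv (filterI hdh hmin).
have e0' : (0 : R) \in `]-e, e[ by rewrite in_itv /= oppr_lt0 e0.
have [/@derive_val <- _] := eP _ e0'; apply: derive_val.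
apply: (@derive1_at_min _ h (-e) e) => //; first by rewrite ge0_cp// ltW.
  by move=> t /eP[[]].
by move=> t /eP[].
Qed.

(** If [c < 0], then, as [dh 0 = 0], the quotient [dh t / t] is negative for small nonzero [t], and
    the mean value theorem on a short interval [[0, t]] gives [h t < h 0]. *)
Lemma second_derivative_ge0_at_min (h dh : R -> R) (c : R) :
  (\forall t \near (0 : R), is_derive t (1 : R) h (dh t)) ->
  (\forall t \near (0 : R), h 0 <= h t) ->
  is_derive (0 : R) (1 : R) dh c -> 0 <= c.
Proof.
move=> hdh hmin dhc; rewrite leNgt; apply/negP => c0.
have [e e0 eP] := near0_itv (filterI hdh hmin).
have e0' : (0 : R) \in `]-e, e[ by rewrite in_itv /= oppr_lt0 e0.
have dh0 := derive_eq0_at_min hdh hmin.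
have /cvgr_lt/(_ _ c0) : (fun t => t^-1 * dh t) @ 0^' --> c.
  have [+ dc] := dhc; rewrite /derivable -/('D_1 dh 0) => /cvg_toP/(_ dc).
  apply: cvg_trans; apply: near_eq_cvg; near=> t.
  by rewrite /= dh0 subr0 addr0 [t%:A]mulr1.
rewrite near_withinE => /nbhs_ballP[d /= d0 dP].
(* Within [e] of 0, [h] is differentiable and at least [h 0]; within [d], the quotient is negative.
   Halving puts [t] strictly inside both. *)
pose t := Num.min (d / 2) (e / 2).
have t0 : 0 < t by rewrite lt_min !divr_gt0.
have te : t < e by rewrite gt_min [X in _ || X]ltr_pdivrMr// ltr_pMr// ltr1n orbT.
have td : t < d by rewrite gt_min ltr_pdivrMr// ltr_pMr// ltr1n.
have inE s : 0 <= s -> s <= t -> s \in `]-e, e[.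
  move=> s0 st; rewrite in_itv /= (le_lt_trans st te) andbT.
  by rewrite (lt_le_trans _ s0)// oppr_lt0.
have hder s : s \in `[0, t] -> is_derive s (1 : R) h (dh s).
  by rewrite in_itv /= => /andP[s0 st]; have [] := eP _ (inE _ s0 st).
have hcont : {within `[0, t], continuous h}.
  by apply: derivable_within_continuous => s /hder[].
have hder_oo s : s \in `]0, t[ -> is_derive s (1 : R) h (dh s).
  by move=> /subset_itv_oo_cc; exact: hder.
have [s] := MVT t0 hder_oo hcont.
rewrite in_itv /= subr0 => /andP[s0 st] hE.
have [_] := eP _ (inE _ (ltW t0) (lexx t)).
(* The sign of [h t - h 0 = dh s * t] is that of [dh s], hence that of [s^-1 * dh s]. *)
apply/negP; rewrite -ltNge -subr_lt0 hE pmulr_llt0//.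
rewrite -(@pmulr_rlt0 _ s^-1) ?invr_gt0//; apply: dP; last by rewrite gt_eqF.
by rewrite -ball_normE /= sub0r normrN gtr0_norm// (lt_trans st).
Unshelve. all: by end_near. Qed.

(** Moving [t] by [h] moves the point by [h *: v], so both difference quotients coincide. *)
Lemma is_derive_line (V W : normedModType R) (F : V -> W) (x v : V) (t : R) :
  derivable F (x + t *: v) v ->
  is_derive t 1 (fun s : R => F (x + s *: v)) ('D_v F (x + t *: v)).
Proof.
have E : (fun h : R => h^-1 *:
      (((fun s : R => F (x + s *: v)) \o shift t) (h *: 1) - F (x + t *: v))) =
    (fun h : R => h^-1 *:
      ((F \o shift (x + t *: v)) (h *: v) - F (x + t *: v))).
  by apply/funext => h /=; rewrite [h%:A]mulr1 scalerDl addrCA.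
move=> dF; apply: DeriveDef; first by rewrite /derivable E.
by rewrite /derive E.
Qed.

End second_order.

(** * Directional derivatives through the gradient and the Hessian *)

Section grad.
Context {R : realType} {n : nat}.
Implicit Types (F : 'cV[R]_n -> R) (x v : 'cV[R]_n).

Lemma derive_gradient F x v : differentiable F x ->
  'D_v F x = (gradient F x *m v) 0 0.
Proof.
move=> dF; rewrite deriveE// [in LHS](matrix_sum_delta v) linear_sum mxE.
apply: eq_bigr => j _; rewrite big_ord1 linearZ/= mxE deriveE//; exact: mulrC.
Qed.

(** The pairing combines the partial derivatives with constant weights [v j 0]; [derive_gradient]
    applied to the [j]-th partial yields column [j] of the Hessian. *)
Lemma derive_gradient_dot F x v : differentiable (gradient F) x ->
  is_derive x v (fun y => (gradient F y *m v) 0 0)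
    ((v^T *m hessian F x *m v) 0 0).
Proof.
move=> dG.
have dGj j : differentiable ('D_(basis_vec j) F) x.
  have -> : 'D_(basis_vec j) F = (fun N : 'rV[R]_n => N 0 j) \o gradient F.
    by apply/funext => y; rewrite /= mxE.
  by apply: differentiable_comp => //; exact: differentiable_coord.
have -> : (fun y => (gradient F y *m v) 0 0) =
    \sum_(j < n) (v j 0 *: 'D_(basis_vec j) F).
  apply/funext => y; rewrite mxE fct_sumE; apply: eq_bigr => j _.
  by rewrite mxE mulrC.
have dGv j : is_derive x v (v j 0 *: 'D_(basis_vec j) F)
    (v j 0 *: (\sum_i v i 0 * hessian F x i j)).
  apply: is_deriveZ; apply: DeriveDef; first exact: diff_derivable.
  by rewrite derive_gradient// mxE; apply: eq_bigr => i _; rewrite !mxE mulrC.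
apply: is_derive_eq; rewrite [RHS]mxE; apply: eq_bigr => j _.
rewrite [in RHS]mulrC [in RHS]mxE; congr (_ * _).
by apply: eq_bigr => i _; rewrite [v^T _ _]mxE.
Qed.

End grad.

(** * Necessary conditions at a minimum over an open set *)

Section local_minimum.
Context {R : realType} {n : nat}.
Variables (X : set 'cV[R]_n) (F : 'cV[R]_n -> R) (x : 'cV[R]_n).
Hypotheses (X_open : open X) (F_diff : twice_differentiable X F).
Hypotheses (Xx : X x) (F_min : forall y, X y -> F x <= F y).

Let near_line (v : 'cV[R]_n) : \forall t \near (0 : R), X (x + t *: v).
Proof.
have : (fun t : R => x + t *: v) @ (0 : R) --> x + 0 *: v.
  by apply: cvgD; [exact: cvg_cst|apply: cvgZr_tmp; exact: cvg_id].
by apply; rewrite scale0r addr0; exact: open_nbhs_nbhs.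
Qed.

Let near_derive_line (v : 'cV[R]_n) : \forall t \near (0 : R),
  is_derive t (1 : R) (fun s => F (x + s *: v))
    ((gradient F (x + t *: v) *m v) 0 0).
Proof.
have Xv := near_line v; near=> t; have Xt : X (x + t *: v) by near: t.
have [dFt _] := F_diff Xt.
by rewrite -derive_gradient//; apply: is_derive_line; exact: diff_derivable.
Unshelve. all: by end_near. Qed.

Let near_min_line (v : 'cV[R]_n) : \forall t \near (0 : R),
  F (x + 0 *: v) <= F (x + t *: v).
Proof.
have Xv := near_line v.
by near=> t; rewrite scale0r addr0; apply: F_min; near: t.
Unshelve. all: by end_near. Qed.

Lemma gradient_eq0_at_min : gradient F x = 0.
Proof.
apply/rowP => j; have [dF _] := F_diff Xx.
have := derive_eq0_at_min (near_derive_line _) (near_min_line (basis_vec j)).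
by rewrite scale0r addr0 -derive_gradient// !mxE.
Qed.

(** The form is the second derivative at 0 of [F] along the line through [x] in direction [v]. *)
Lemma hessian_ge0_at_min (v : 'cV[R]_n) : 0 <= (v^T *m hessian F x *m v) 0 0.
Proof.
apply: (second_derivative_ge0_at_min (near_derive_line v) (near_min_line v)).
have [_ dG] := F_diff Xx; have [dv dvE] := derive_gradient_dot v dG.
have := @is_derive_line _ _ _ (fun y => (gradient F y *m v) 0 0) x v 0.
by rewrite scale0r addr0 dvE; apply.
Qed.

End local_minimum.

(** The [k]-th diagonal entry is the quadratic form of [H] at the [k]-th column of [S]. *)
Lemma mxtrace_congr_ge0 (R : realType) (n p : nat) (H : 'M[R]_n)
    (S : 'M[R]_(n, p)) :
  (forall v : 'cV_n, 0 <= (v^T *m H *m v) 0 0) -> 0 <= \tr (S^T *m H *m S).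
Proof.
move=> H0; apply: sumr_ge0 => k _; have := H0 (col k S).
rewrite tr_col -row_mul [in X in X -> _]mxE [in X in _ -> X]mxE.
by under eq_bigr do rewrite !mxE; under [in X in _ -> X]eq_bigr do rewrite mxE.
Qed.

Lemma sclbf_gt_origin (R : realType) (n m : nat) (X D : set 'cV[R]_n)
    (f : 'cV[R]_n -> 'cV[R]_n) (g : 'cV[R]_n -> 'M[R]_(n, m))
    (sigma : 'cV[R]_n -> 'M[R]_n) (U : set 'cV[R]_m) (W : 'cV[R]_n -> R) :
  open X -> sclbf f g sigma X U D W ->
  forall x, X x -> x != 0 -> W 0 < W x.
Proof.
move=> Xo [dW [X0 Wmin] Wpos Winf [y [Xy Wy]]] x Xx x0.
(* On D, W > 0 while min W <= 0 by (iii); off D, a second minimum would have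
   zero gradient and nonnegative Ito term, so no input could satisfy (ii). *)
have [Dx|Dx] := pselect (D x).
  by rewrite (le_lt_trans (Wmin _ Xy))// (le_lt_trans Wy)// Wpos.
rewrite lt_neqAle Wmin// andbT; apply/eqP => W0x.
have xmin z : X z -> W x <= W z by rewrite -W0x; exact: Wmin.
have : (0 <= ereal_inf [set (generator f g sigma W x u)%:E | u in U])%E.
  apply: le_ereal_inf_tmp => _ [u _ <-]; rewrite lee_fin /generator /Lf /Lg.
  rewrite (gradient_eq0_at_min Xo dW Xx xmin) !mul0mx !mxE !add0r.
  rewrite mulr_ge0// mxtrace_congr_ge0// => v.
  exact: (hessian_ge0_at_min Xo dW Xx xmin).
rewrite leNgt Winf//; split=> //= -[//|/eqP]; exact/negP.
Qed.

Theorem proposition4 (R : realType) (n m : nat)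
    (X : set 'cV[R]_n) (D : set 'cV[R]_n)
    (f : 'cV[R]_n -> 'cV[R]_n) (g : 'cV[R]_n -> 'M[R]_(n, m))
    (sigma : 'cV[R]_n -> 'M[R]_n)
    (umax rho : R) (Wc : 'cV[R]_n -> R)
    (X_open : open X)
    (f_lip : locally_lipschitz X f)
    (g_lip : locally_lipschitz X g)
    (sigma_lip : locally_lipschitz X sigma)
    (D_unsafe : unsafe_region X D)
    (umax_ge0 : 0 <= umax)
    (Wc_sclbf : sclbf f g sigma X (input_ball umax) D Wc)
    (rho_gt0 : 0 < rho) :
  forall x : 'cV[R]_n, X_phi f g sigma X umax rho Wc x -> x != 0 ->
    [/\ input_ball umax (phi f g sigma umax rho Wc x),
        generator f g sigma Wc x (phi f g sigma umax rho Wc x)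
          <= - (rho * Vc Wc x) &
        - (rho * Vc Wc x) < 0].
Proof.
move=> x [Xx]; set a := coef_a f sigma rho Wc x; set b := Lg g Wc x.
rewrite enormZ ger0_norm// => ab x0.
have V0 : 0 < Vc Wc x by rewrite subr_gt0 (sclbf_gt_origin X_open Wc_sclbf).
(* In this form the decrease condition becomes [a + (b *m u) 0 0 <= 0]. *)
have genE u : generator f g sigma Wc x u = a + (b *m u) 0 0 - rho * Vc Wc x.
  by rewrite /generator /a /coef_a -/b; ring.
rewrite genE /input_ball /= /phi -/a -/b enormZ ger0_norm//.
split; last by rewrite oppr_lt0 mulr_gt0.
- case: ifPn => [_|/enorm_gt0 b0].
    by rewrite -(scale0r 0) enormZ normr0 mul0r.
  have ub0 : 0 <= umax * enorm b by rewrite mulr_ge0// ltW.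
  have := sontag_numerator_le ub0 ab; set N := a + _; set T := 1 + _ => NT.
  have T0 : 0 < T by rewrite ltr_pwDl// sqrtr_ge0.
  (* The root dominates the absolute value of [a], so the scalar factor of [phi] has known sign and
     its norm needs no case split. *)
  have N0 : 0 <= N.
    rewrite -lerBlDl sub0r (le_trans (ler_norm _))// normrN -sqrtr_sqr.
    by rewrite ler_wsqrtr// lerDl exprn_ge0.
  rewrite enormZ enormT normrN ger0_norm; last first.
    by rewrite divr_ge0// mulr_ge0 ?exprn_ge0// ltW.
  (* With denominators cleared, the bound is [NT] multiplied by [enorm b]. *)
  rewrite mulrAC ler_pdivrMr ?mulr_gt0 ?exprn_gt0//.
  by apply: le_trans (ler_wpM2r (ltW b0) NT) _; rewrite expr2 !mulrA mulrAC.
- rewrite -[leRHS]add0r lerD2r; case: ifPn => [/eqP b0|/enorm_gt0 b0].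
    (* For [b = 0], membership in [X_phi] says exactly [a <= 0]. *)
    by rewrite mulmx0 mxE addr0 (le_trans ab)// b0 -(scale0r 0) enormZ normr0 mul0r mulr0.
  have ub0 : 0 <= umax * enorm b by rewrite mulr_ge0// ltW.
  have := sontag_numerator_ge ub0 ab; set N := a + Num.sqrt _; set T := 1 + _ => NT.
  have T0 : 0 < T by rewrite ltr_pwDl// sqrtr_ge0.
  (* The product of [b] with the input is [- N / T], so [a <= N / T] remains. *)
  rewrite -scalemxAr mxE mulmx_row_trmx mulNr subr_le0.
  have b2 : 0 < enorm b ^+ 2 by rewrite exprn_gt0.
  by rewrite mulrAC ler_pdivlMr ?mulr_gt0// mulrCA [leRHS]mulrC ler_pM2l.
Qed.
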